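(* Let $0<\epsilon<1/3$ be real and let $n$ be an integer with $n\geq\max\{9,2/\epsilon\}$. Let $\mathrm{SL}_n(\mathbf{C})$ act on $\mathfrak{sl}_n(\mathbf{C})$ by conjugation. If $U\leq\mathfrak{sl}_n(\mathbf{C})$ is a linear subspace with $\dim U>\epsilon n^2$, then \[ \mathrm{diam}_+^{\mathrm{SL}_n(\mathbf{C})}(\mathfrak{sl}_n(\mathbf{C}),U)\leq \frac{3456}{\epsilon}\left\lceil\log_2\frac{4}{\epsilon}\right\rceil . \]
   Context: For a group $G$, a finite-dimensional complex representation $\rho\colon G\to\mathrm{GL}(V)$ and a linear subspace $U\leq V$, the $G$-additive diameter of $V$ with respect to $U$ is \[ \mathrm{diam}_+^G(V,U)=\min\{d \mid \rho(g_1)\cdot U+\dots+\rho(g_d)\cdot U=V \text{ for some } g_1,\dots,g_d\in G\}, \] with value $\infty$ if no such $d$ exists. $\mathfrak{sl}_n(\mathbf{C})$ is the space of traceless complex $n\times n$ matrices. *)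

(* Defs.v *)
From HB Require Import structures.
From mathcomp Require Import all_boot all_order all_algebra complex.
From mathcomp Require Import boolp reals constructive_ereal exp.

Set Implicit Arguments.
Unset Strict Implicit.
Unset Printing Implicit Defensive.

Import Order.TTheory GRing.Theory Num.Theory.
Local Open Scope ring_scope.

(* A homomorphism G -> GL(V): invertibility of each [rho g] follows from the
   two laws, as G is a group. *)
Record representation (K : fieldType) (G : groupType) (V : vectType K) := {
  rep_fun :> G -> 'End(V);
  rep1 : rep_fun 1%g = \1%VF;
  repM : forall g h : G, rep_fun (g * h)%g = (rep_fun g \o rep_fun h)%VF }.

(* [d = 0] is allowed; this matters only when [V] is zero. *)
Definition translates_span (K : fieldType) (G : groupType) (V : vectType K)
    (rho : representation G V) (U : {vspace V}) (d : nat) : Prop :=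
  exists g : 'I_d -> G, (\sum_(i < d) (rho (g i) @: U))%VS = fullv.

Lemma translates_span_bool (K : fieldType) (G : groupType) (V : vectType K)
    (rho : representation G V) (U : {vspace V}) :
  (exists d, translates_span rho U d) -> exists d, `[< translates_span rho U d >].
Proof. by case=> d dP; exists d; apply/asboolP. Qed.

Definition diam_add (R : numDomainType) (K : fieldType) (G : groupType)
    (V : vectType K) (rho : representation G V) (U : {vspace V}) : \bar R :=
  if pselect (exists d, translates_span rho U d) is left h
  then (ex_minn (translates_span_bool h))%:R%:E else +oo%E.

Record SL (K : comUnitRingType) (n : nat) := MkSL {
  SLval :> 'M[K]_n;
  SLP : \det SLval == 1 }.

HB.instance Definition _ (K : comUnitRingType) (n : nat) :=
  [isSub for @SLval K n].
HB.instance Definition _ (K : comUnitRingType) (n : nat) :=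
  [Choice of SL K n by <:].

Lemma SL_unitmx (K : comUnitRingType) (n : nat) (g : SL K n) :
  (g : 'M_n) \in unitmx.
Proof. by rewrite unitmxE (eqP (SLP g)) unitr1. Qed.

Lemma SL1_subproof (K : comUnitRingType) (n : nat) :
  \det (1%:M : 'M[K]_n) == 1.
Proof. by rewrite det1. Qed.
Lemma SLM_subproof (K : comUnitRingType) (n : nat) (g h : SL K n) :
  \det (g *m h) == 1.
Proof. by rewrite det_mulmx (eqP (SLP g)) (eqP (SLP h)) mulr1. Qed.
Lemma SLV_subproof (K : comUnitRingType) (n : nat) (g : SL K n) :
  \det (invmx g) == 1.
Proof. by rewrite det_inv (eqP (SLP g)) invr1. Qed.

Definition SL_one (K : comUnitRingType) (n : nat) : SL K n :=
  MkSL (SL1_subproof K n).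
Definition SL_mul (K : comUnitRingType) (n : nat) (g h : SL K n) : SL K n :=
  MkSL (SLM_subproof g h).
Definition SL_inv (K : comUnitRingType) (n : nat) (g : SL K n) : SL K n :=
  MkSL (SLV_subproof g).

Lemma SL_mulA (K : comUnitRingType) (n : nat) : associative (@SL_mul K n).
Proof. by move=> x y z; apply: val_inj; rewrite /= mulmxA. Qed.
Lemma SL_mul1 (K : comUnitRingType) (n : nat) :
  left_id (SL_one K n) (@SL_mul K n).
Proof. by move=> x; apply: val_inj; rewrite /= mul1mx. Qed.
Lemma SL_mulr1 (K : comUnitRingType) (n : nat) :
  right_id (SL_one K n) (@SL_mul K n).
Proof. by move=> x; apply: val_inj; rewrite /= mulmx1. Qed.
Lemma SL_mulV (K : comUnitRingType) (n : nat) :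
  left_inverse (SL_one K n) (@SL_inv K n) (@SL_mul K n).
Proof. by move=> x; apply: val_inj; rewrite /= mulVmx ?SL_unitmx. Qed.
Lemma SL_mulrV (K : comUnitRingType) (n : nat) :
  right_inverse (SL_one K n) (@SL_inv K n) (@SL_mul K n).
Proof. by move=> x; apply: val_inj; rewrite /= mulmxV ?SL_unitmx. Qed.

HB.instance Definition _ (K : comUnitRingType) (n : nat) :=
  isGroup.Build (SL K n) (@SL_mulA K n) (@SL_mul1 K n) (@SL_mulr1 K n)
    (@SL_mulV K n) (@SL_mulrV K n).

Definition sl (K : fieldType) (n : nat) : {vspace 'M[K]_n} :=
  lker (linfun (mxtrace : 'M[K]_n -> K^o)).

Lemma mem_sl (K : fieldType) (n : nat) (x : 'M[K]_n) :
  (x \in sl K n) = (\tr x == 0).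
Proof. by rewrite memv_ker lfunE. Qed.

Definition sl_type (K : fieldType) (n : nat) : vectType K := subvs_of (sl K n).

Lemma conj_sl (K : fieldType) (n : nat) (g : SL K n) (x : sl_type K n) :
  g *m vsval x *m invmx g \in sl K n.
Proof.
by rewrite mem_sl mxtrace_mulC mulmxA mulVmx ?SL_unitmx// mul1mx -mem_sl subvsP.
Qed.

Definition sl_conj (K : fieldType) (n : nat) (g : SL K n) (x : sl_type K n) :
  sl_type K n := Subvs (conj_sl g x).

Lemma sl_conj_linear (K : fieldType) (n : nat) (g : SL K n) :
  linear (sl_conj g).
Proof.
move=> a x y; apply: val_inj; rewrite /=.
by rewrite mulmxDr -scalemxAr mulmxDl -scalemxAl.
Qed.

HB.instance Definition _ (K : fieldType) (n : nat) (g : SL K n) :=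
  GRing.isLinear.Build K (sl_type K n) (sl_type K n) *:%R (sl_conj g)
    (@sl_conj_linear K n g).

Lemma sl_conj1 (K : fieldType) (n : nat) :
  linfun (sl_conj (1%g : SL K n)) = \1%VF.
Proof.
apply/lfunP => x; apply: val_inj; rewrite !lfunE /=.
by rewrite mul1mx invmx1 mulmx1.
Qed.

Lemma sl_conjM (K : fieldType) (n : nat) (g h : SL K n) :
  linfun (sl_conj (g * h)%g) = (linfun (sl_conj g) \o linfun (sl_conj h))%VF.
Proof.
apply/lfunP => x; apply: val_inj; rewrite comp_lfunE !lfunE /=.
have -> : invmx (SLval g *m SLval h) = invmx h *m invmx g.
  have u : SLval g *m SLval h \in unitmx by rewrite unitmx_mul !SL_unitmx.
  by apply: (can_inj (mulKmx u)); rewrite mulmxV// !mulmxA mulmxK ?SL_unitmx// mulmxV ?SL_unitmx.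
by rewrite !mulmxA.
Qed.

Definition sl_rep (K : fieldType) (n : nat) :
    representation (SL K n) (sl_type K n) :=
  {| rep_fun := fun g => linfun (sl_conj g);
     rep1 := sl_conj1 K n; repM := @sl_conjM K n |}.

Definition log2 (R : realType) (x : R) : R := ln x / ln 2.

(* Main.v *)
Require Import Defs.
From HB Require Import structures.
From mathcomp Require Import all_boot all_order all_algebra all_fingroup complex.
From mathcomp Require Import boolp reals constructive_ereal exp.
From mathcomp Require Import zify ring lra.

Import Order.TTheory GRing.Theory Num.Theory.
Local Open Scope ring_scope.

(** Conjugates by GL_n may be rescaled into SL_n.  The lexicographic pivots of
    [U] are [dim U] matrix positions, and for some [A] with complement [B] about
    a quarter of them lie in [A * B]; three conjugates by diagonal matrices
    contain the [A * B] blocks of [U].  A dyadic pigeonhole gives [p] rows with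
    at least [q] pivots each, where [p q >= D / (4 L)] and [D] is the number of
    pivots in [A * B].  About [|B| / q] generic changes of basis of the
    [B] coordinates make these [p] rows arbitrary, and two more diagonal
    conjugates isolate them as a full [p * |B|] block.  Permuting it covers the
    two off-diagonal blocks of a half-half splitting with [2 n^2 / (p |B|)]
    conjugates, and four conjugates of those cover sl_n, because only scalar
    matrices are orthogonal to all of them for the trace form. *)

(** * Conjugation and the covering relation *)

Definition conjm {K : fieldType} {n} (g : 'M[K]_n) : 'End('M[K]_n) :=
  linfun (mulmxr (invmx g) \o mulmx g).

Lemma conjmE (K : fieldType) n (g x : 'M[K]_n) :
  conjm g x = g *m x *m invmx g.
Proof. by rewrite lfunE. Qed.

Lemma conjmM (K : fieldType) n (g h : 'M[K]_n) :
  g \in unitmx -> h \in unitmx -> conjm (g *m h) = (conjm g \o conjm h)%VF.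
Proof.
move=> ug uh; apply/lfunP => x; rewrite comp_lfunE !conjmE.
have -> : invmx (g *m h) = invmx h *m invmx g.
  have u : g *m h \in unitmx by rewrite unitmx_mul ug.
  apply: (can_inj (mulKmx u)).
  by rewrite mulmxV// !mulmxA mulmxK// mulmxV.
by rewrite !mulmxA.
Qed.

(** Any finite index type of size at most [N] is allowed, so that products and disjoint unions of
    families serve directly; conjugators range over [GL_n]. *)
Definition covers {K : fieldType} {n} (N : nat) (U W : {vspace 'M[K]_n}) :=
  exists (T : finType) (g : T -> 'M[K]_n),
    [/\ (#|T| <= N)%N, forall t, g t \in unitmx
      & (W <= \sum_t (conjm (g t) @: U))%VS].

Lemma covers_trans (K : fieldType) n N M (U V W : {vspace 'M[K]_n}) :
  covers N U V -> covers M V W -> covers (N * M) U W.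
Proof.
move=> [T [g [gN gu gV]]] [S [h [hM hu hW]]].
exists (S * T)%type, (fun p => h p.1 *m g p.2); split.
- by rewrite card_prod mulnC leq_mul.
- by move=> p; rewrite unitmx_mul hu gu.
apply: subv_trans hW _.
rewrite -(pair_big predT predT
  (fun s t => conjm (h s *m g t) @: U)%VS) /=.
apply: subv_trans (_ : \sum_s (conjm (h s) @:
  (\sum_t (conjm (g t) @: U))) <= _)%VS.
  apply/subv_sumP => s _; apply: subv_trans (limgS _ gV) _.
  exact: (sumv_sup s).
apply/subv_sumP => s _; apply: (sumv_sup s) => //.
rewrite limg_sum; apply/subv_sumP => t _; apply: (sumv_sup t) => //.
by rewrite conjmM ?hu ?gu// limg_comp.
Qed.

Lemma coversS (K : fieldType) n N M (U W W' : {vspace 'M[K]_n}) :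
  (N <= M)%N -> (W' <= W)%VS -> covers N U W -> covers M U W'.
Proof.
move=> NM WW [T [g [gN gu gW]]]; exists T, g; split=> //.
  exact: leq_trans NM.
exact: subv_trans gW.
Qed.

Lemma coversD (K : fieldType) n N M (U V W : {vspace 'M[K]_n}) :
  covers N U V -> covers M U W -> covers (N + M) U (V + W).
Proof.
move=> [T [g [gN gu gV]]] [S [h [hM hu hW]]].
exists (T + S)%type, (fun p => match p with inl t => g t | inr s => h s end).
split=> [||]; first by rewrite card_sum leq_add.
  by case=> ?; rewrite ?gu ?hu.
rewrite subv_add; apply/andP; split.
  apply: subv_trans gV _; apply/subv_sumP => t _.
  by rewrite (sumv_sup (inl t)).
apply: subv_trans hW _; apply/subv_sumP => s _.
by rewrite (sumv_sup (inr s)).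
Qed.

Lemma covers_sum (K : fieldType) n N (U : {vspace 'M[K]_n}) (I : finType)
    (W : I -> {vspace 'M[K]_n}) :
  (forall i, covers N U (W i)) -> covers (#|I| * N) U (\sum_i W i).
Proof.
move=> UW; pose T i := projT1 (cid (UW i)).
have /= gP0 i := projT2 (cid (UW i)).
pose g i := projT1 (cid (gP0 i)); have gP i := projT2 (cid (gP0 i)).
exists {i : I & T i}, (fun p => g (tag p) (tagged p)); split=> [|p|].
- rewrite card_tagged sumnE big_map big_enum -sum_nat_const /=.
  by apply: leq_sum => i _; case: (gP i).
- by case: (gP (tag p)) => _ + _; apply.
apply/subv_sumP => i _; case: (gP i) => _ _ gW; apply: subv_trans gW _.
apply/subv_sumP => t _.
exact: (sumv_sup (Tagged T t)).
Qed.

(** * Trace duality and diagonal conjugation of blocks *)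

(** The entries of [x - projv V x] are linear forms in [x] that vanish on [V], and every linear form
    on matrices is the trace against some [y]; the hypothesis then kills each entry on [W]. *)
Lemma subv_trace_orth (K : fieldType) n (W V : {vspace 'M[K]_n}) :
  (forall y, (forall x, x \in V -> \tr (y *m x) = 0) ->
             forall x, x \in W -> \tr (y *m x) = 0) ->
  (W <= V)%VS.
Proof.
move=> orth; apply/subvP => x xW.
suff: x - projv V x = 0 by move/subr0_eq ->; exact: memv_proj.
apply/matrixP => i j; rewrite [RHS]mxE.
pose phi (z : 'M[K]_n) := (z - projv V z) i j.
have phiD : {morph phi : y z / y + z}.
  by move=> y z; rewrite /phi linearD/= !mxE; ring.
have phiZ a z : phi (a *: z) = a * phi z.
  by rewrite /phi linearZ/= !mxE; ring.
have phi0 : phi 0 = 0 by rewrite /phi linear0 subr0 mxE.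
pose y := \matrix_(b, a) phi (delta_mx a b).
have phiE z : \tr (y *m z) = phi z.
  rewrite [in RHS](matrix_sum_delta z) (big_morph phi phiD phi0).
  transitivity (\sum_a \sum_b y b a * z a b).
    by rewrite exchange_big; apply: eq_bigr => b _; rewrite mxE.
  apply: eq_bigr => a _; rewrite (big_morph phi phiD phi0).
  by apply: eq_bigr => b _; rewrite mxE phiZ mulrC.
rewrite -[LHS]/(phi x) -phiE; apply: orth xW => z zV.
by rewrite phiE /phi projv_id// subrr mxE.
Qed.

Definition blk {K : fieldType} {n} (P Q : {set 'I_n}) (x : 'M[K]_n) : 'M[K]_n :=
  \matrix_(i, j) (x i j *+ ((i \in P) && (j \in Q))).

Fact blk_is_linear (K : fieldType) n (P Q : {set 'I_n}) :
  linear (@blk K n P Q).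
Proof.
move=> a x y; apply/matrixP => i j; rewrite !mxE.
by case: (_ && _); rewrite ?mulr1n// !mulr0n mulr0 addr0.
Qed.

HB.instance Definition _ (K : fieldType) n (P Q : {set 'I_n}) :=
  GRing.isLinear.Build K 'M[K]_n 'M[K]_n *:%R (blk P Q)
    (@blk_is_linear K n P Q).

Definition suppv (K : fieldType) {n} (P Q : {set 'I_n}) : {vspace 'M[K]_n} :=
  limg (linfun (blk P Q)).

Lemma suppvP (K : fieldType) n (P Q : {set 'I_n}) (x : 'M[K]_n) :
  reflect (forall i j, ~~ ((i \in P) && (j \in Q)) -> x i j = 0)
          (x \in suppv K P Q).
Proof.
apply: (iffP idP) => [/memv_imgP[y _ ->] i j /negPf ij|x0].
  by rewrite lfunE mxE ij mulr0n.
have -> : x = linfun (blk P Q) x; last by rewrite memv_img ?memvf.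
apply/matrixP => i j; rewrite lfunE mxE.
by case: (boolP (_ && _)) => [//|/x0 ->]; rewrite mul0rn.
Qed.

Lemma conjm_eq (K : fieldType) n (g x y : 'M[K]_n) :
  g \in unitmx -> g *m x = y *m g -> conjm g x = y.
Proof. by move=> ug gx; rewrite conjmE gx mulmxK. Qed.

Definition dg {K : fieldType} {n} (d : 'I_n -> K) : 'M[K]_n :=
  diag_mx (\row_i d i).

Lemma dg_unit (K : fieldType) n (d : 'I_n -> K) :
  (forall i, d i != 0) -> dg d \in unitmx.
Proof.
move=> d0; rewrite unitmxE det_diag unitfE; apply/prodf_neq0 => i _.
by rewrite mxE.
Qed.

Lemma conj_dg (K : fieldType) n (d : 'I_n -> K) (x : 'M[K]_n) :
  (forall i, d i != 0) -> conjm (dg d) x = \matrix_(i, j) (d i * x i j / d j).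
Proof.
move=> d0; apply: conjm_eq; first exact: dg_unit.
apply/matrixP => i j; rewrite mul_diag_mx mul_mx_diag !mxE.
by rewrite divfK.
Qed.

(** Scaling the coordinates in [A] by [s] multiplies the [A * ~: A] block by [s], the opposite block
    by [1 / s], and fixes the diagonal blocks. The weights [c] at [s = 1, -1, 2] solve [sum c = 0],
    [sum c / s = 0], [sum c s = 1]. *)
Lemma covers_blk (K : numFieldType) n (A : {set 'I_n}) (U : {vspace 'M[K]_n}) :
  covers 3 U (linfun (blk A (~: A)) @: U).
Proof.
pose s (k : 'I_3) : K := [:: 1; -1; 2]`_k.
pose c (k : 'I_3) : K := [:: - 2^-1; - 6^-1; 2 / 3]`_k.
pose d k (i : 'I_n) := if i \in A then s k else 1.
have d0 k i : d k i != 0.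
  rewrite /d; case: ifP; rewrite ?oner_eq0// => _.
  by case: k => -[|[|[|//]]] p; rewrite /s /= ?oppr_eq0 ?oner_eq0 ?pnatr_eq0.
exists 'I_3, (fun k => dg (d k)); split; first by rewrite card_ord.
  by move=> k; apply: dg_unit.
apply/subvP => _ /memv_imgP[x xU ->].
have -> : linfun (blk A (~: A)) x = \sum_k c k *: conjm (dg (d k)) x.
  apply/matrixP => i j; rewrite lfunE summxE mxE.
  under eq_bigr => k _ do rewrite conj_dg// !mxE.
  rewrite !big_ord_recl big_ord0 /c /= /d inE /s /=.
  by case: (i \in A); case: (j \in A); rewrite /= ?mulr0n ?mulr1n; field.
by apply: memv_sumr => k _; apply/rpredZ/memv_img.
Qed.

(** Doubling the coordinates in [I] and subtracting the original retains exactly the rows in [I]: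
    the columns in [I] of an element of [W] vanish, because [I] lies in [A]. *)
Lemma covers_rows (K : numFieldType) n (A I : {set 'I_n})
    (W : {vspace 'M[K]_n}) :
  I \subset A -> (W <= suppv K A (~: A))%VS ->
  (forall z, z \in suppv K I (~: A) ->
     exists2 w, w \in W & forall i j, i \in I -> w i j = z i j) ->
  covers 2 W (suppv K I (~: A)).
Proof.
move=> /subsetP IA WA sur.
pose d (b : bool) (i : 'I_n) : K := if b && (i \in I) then 2 else 1.
have d0 b i : d b i != 0.
  by rewrite /d; case: ifP; rewrite ?oner_eq0 ?pnatr_eq0.
exists bool, (fun k => dg (d k)); split; first by rewrite card_bool.
  by move=> k; apply: dg_unit.
apply/subvP => z zI; have [w wW wz] := sur z zI.
have -> : z = \sum_b (if b then 1 else -1) *: conjm (dg (d b)) w.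
  rewrite big_bool /=; apply/matrixP => i j; rewrite !mxE !conj_dg// !mxE.
  have wA i' j' : ~~ ((i' \in A) && (j' \in ~: A)) -> w i' j' = 0.
    by apply/suppvP: i' j'; apply: (subvP WA).
  rewrite /d /=; case: (boolP (i \in I)) => iI; last first.
    have -> : z i j = 0 by move/suppvP: zI; apply; rewrite (negPf iI).
    case: (boolP (j \in I)) => jI; last by field.
    by rewrite wA ?inE ?(IA _ jI) ?andbF//; field.
  rewrite -wz//; case: (boolP (j \in I)) => jI; last by field.
  by rewrite wA ?inE ?(IA _ jI) ?andbF//; field.
by apply: memv_sumr => k _; apply/rpredZ/memv_img.
Qed.

(** * Covering rectangles by permuted blocks *)

Lemma perm_map_uniq (T : finType) (s s' : seq T) :
  uniq s -> uniq s' -> size s = size s' -> exists f : {perm T}, map f s = s'.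
Proof.
elim: s s' => [|x s IHs] [|y s'] //=; first by exists 1%g.
case/andP=> xs us /andP[ys us'] [ss]; have [f fs] := IHs s' us us' ss.
(* The transposition corrects the image of [x] and fixes all of [s'], since neither [f x] nor [y]
   lies in [s']. *)
exists (f * tperm (f x) y)%g; rewrite permM tpermL; congr (_ :: _).
rewrite -fs; apply/eq_in_map => z zs; rewrite permM tpermD//.
  by rewrite (inj_eq perm_inj); apply: contraNneq xs => ->.
by apply: contraNneq ys => ->; rewrite -fs map_f.
Qed.

Lemma covers_perm (K : fieldType) n (I B X Y : {set 'I_n}) :
  [disjoint I & B] -> [disjoint X & Y] -> (#|X| <= #|I|)%N -> (#|Y| <= #|B|)%N ->
  covers 1 (suppv K I B) (suppv K X Y).
Proof.
move=> dIB dXY XI YB.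
(* One permutation must send [X] into [I] and [Y] into [B]; disjointness makes both concatenated
   lists duplicate-free. *)
have [|||f] := @perm_map_uniq _ (enum X ++ enum Y)
    (take #|X| (enum I) ++ take #|Y| (enum B)).
- rewrite cat_uniq !enum_uniq andbT /=; apply/hasPn => x /=.
  rewrite !mem_enum => xY; apply/negP => xX.
  by move/disjoint_setI0/setP/(_ x): dXY; rewrite !inE xX xY.
- rewrite cat_uniq !take_uniq ?enum_uniq// andbT /=.
  apply/hasPn => x /= /mem_take; rewrite mem_enum => xB.
  apply/negP => /mem_take; rewrite mem_enum => xI.
  by move/disjoint_setI0/setP/(_ x): dIB; rewrite !inE xI xB.
- by rewrite !size_cat !size_take_min -!cardE !(minn_idPl _).
rewrite map_cat => /eqP; rewrite eqseq_cat; last first.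
  by rewrite size_map size_take_min -!cardE (minn_idPl _).
case/andP=> /eqP fX /eqP fY.
have fI x : x \in X -> f x \in I.
  move=> xX; rewrite -mem_enum; apply: (@mem_take #|X|).
  by rewrite -fX map_f ?mem_enum.
have fB x : x \in Y -> f x \in B.
  move=> xY; rewrite -mem_enum; apply: (@mem_take #|Y|).
  by rewrite -fY map_f ?mem_enum.
exists unit, (fun=> perm_mx f); split; rewrite ?card_unit//.
  by move=> _; rewrite unitmx_perm.
apply/subvP => z /suppvP zXY.
rewrite (big_pred1 tt); last by case.
pose x : 'M[K]_n := row_perm f^-1 (col_perm f^-1 z).
have -> : z = conjm (perm_mx f) x.
  apply/esym/conjm_eq; first by rewrite unitmx_perm.
  rewrite -row_permE -[f in RHS]invgK -col_permE /x.
  by apply/matrixP => i j; rewrite !mxE permK.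
apply/memv_img/suppvP => i j nij; rewrite !mxE zXY//.
apply: contraNN nij => /andP[/fI + /fB]; rewrite !permKV => -> -> //.
Qed.

(** The enumeration of [X] is cut by the quotient of the index by [p]; inside a piece the remainder
    is injective. *)
Lemma chunks (T : finType) (X : {set T}) (p c : nat) :
  (0 < p)%N -> (#|X| <= c * p)%N ->
  exists Z : 'I_c -> {set T},
    (forall k, Z k \subset X /\ (#|Z k| <= p)%N) /\
    forall x, x \in X -> exists k, x \in Z k.
Proof.
move=> p0 Xcp; pose ix x := index x (enum X).
exists (fun k : 'I_c => [set x in X | (ix x %/ p)%N == k]); split=> [k|x xX].
  split; first by apply/subsetP => x; rewrite inE => /andP[].
  pose f x : 'I_p := Ordinal (ltn_pmod (ix x) p0).
  rewrite -(card_in_imset (f := f)) => [|x y].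
    by apply: leq_trans (max_card _) _; rewrite card_ord.
  rewrite !inE => /andP[xX /eqP xk] /andP[yX /eqP yk] [xy].
  have : ix x = ix y by rewrite (divn_eq (ix x) p) (divn_eq (ix y) p) xk yk xy.
  by apply: (index_inj x); rewrite mem_enum.
have xc : (ix x %/ p < c)%N.
  rewrite ltn_divLR//; apply: leq_trans Xcp; rewrite cardE /ix.
  by rewrite index_mem mem_enum.
by exists (Ordinal xc); rewrite inE xX /=.
Qed.

Lemma covers_rect (K : fieldType) n c d (I B X Y : {set 'I_n}) :
  [disjoint I & B] -> [disjoint X & Y] -> (0 < #|I|)%N -> (0 < #|B|)%N ->
  (#|X| <= c * #|I|)%N -> (#|Y| <= d * #|B|)%N ->
  covers (c * d) (suppv K I B) (suppv K X Y).
Proof.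
move=> dIB dXY I0 B0 /(chunks _ _ _ _ I0)[Z [ZX XZ]].
move=> /(chunks _ _ _ _ B0)[Z' [ZY YZ]].
pose W (kl : 'I_c * 'I_d) := suppv K (Z kl.1) (Z' kl.2).
have := @covers_sum K n 1 (suppv K I B) _ W.
rewrite card_prod !card_ord muln1 => H.
apply: coversS (leqnn _) _ (H _) => [|[k l]]; last first.
  apply: covers_perm => //; rewrite ?(proj2 (ZX k)) ?(proj2 (ZY l))//=.
  apply: disjointWl (proj1 (ZX k)) _; exact: disjointWr (proj1 (ZY l)) _.
apply/subvP => x /suppvP xXY; rewrite (matrix_sum_delta x).
apply: rpred_sum => i _; apply: rpred_sum => j _.
have [ij|/xXY ->] := boolP ((i \in X) && (j \in Y)); last first.
  by rewrite scale0r mem0v.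
case/andP: ij => /XZ[k ik] /YZ[l jl]; apply: rpredZ.
apply: (subvP (sumv_sup (k, l) _ (subvv _))) => //.
apply/suppvP => i' j'; rewrite mxE; case: eqP => [->|//].
by case: eqP => [->|//]; rewrite ik jl.
Qed.

(** Rounding up at most doubles [x] when [p <= x], and gives [c = 1] otherwise. If neither factor is
    trivial the bound is [4 x y <= n ^ 2]; if only [c] is, it follows from [2 y <= n + 1] and
    [p <= n - 1]. *)
Lemma ceil_mul_le x p b y n c d :
  (0 < p)%N -> (0 < b)%N -> (p + b <= n)%N -> (x + y = n)%N ->
  (x <= y + 1)%N -> (y <= x + 1)%N -> (0 < x)%N -> (0 < y)%N ->
  (c = (x + p.-1) %/ p)%N -> (d = (y + b.-1) %/ b)%N ->
  (c * d * (p * b) <= n * n)%N.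
Proof.
move=> p0 b0 pbn xyn xy yx x0 y0 ce de.
have ceilP u q : (0 < q)%N -> (0 < u)%N ->
    ((q <= u) && (((u + q.-1) %/ q) * q <= 2 * u))%N ||
    ((u < q) && ((u + q.-1) %/ q == 1))%N.
  move=> q0 u0; case: (leqP q u) => qu /=.
    by have := leq_divM (u + q.-1) q; lia.
  have -> : (u + q.-1 = u.-1 + q)%N by lia.
  by rewrite divnDr// divnn q0 divn_small ?prednK// ltnW.
have := ceilP x p p0 x0; have := ceilP y b b0 y0.
rewrite -ce -de; case/orP=> /andP[by1 /[dup] ? by2]; case/orP=> /andP[px1 px2].
- have : (c * p * (d * b) <= (2 * x) * (2 * y))%N by apply: leq_mul.
  by nia.
- rewrite (eqP px2); nia.
- rewrite (eqP by2); nia.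
- nia.
Qed.

Lemma covers_square (K : fieldType) n (I B P : {set 'I_n}) :
  [disjoint I & B] -> (0 < #|I|)%N -> (0 < #|B|)%N ->
  (0 < #|P|)%N -> (0 < #|~: P|)%N ->
  (#|P| <= #|~: P| + 1)%N -> (#|~: P| <= #|P| + 1)%N ->
  exists2 N, covers N (suppv K I B) (suppv K P (~: P) + suppv K (~: P) P)
           & (N * (#|I| * #|B|) <= 2 * (n * n))%N.
Proof.
move=> dIB I0 B0 P0 Q0 PQ QP.
have PQn : (#|P| + #|~: P| = n)%N by rewrite cardsC card_ord.
have IBn : (#|I| + #|B| <= n)%N.
  rewrite -cardsUI (disjoint_setI0 dIB) cards0 addn0.
  by apply: leq_trans (max_card _) _; rewrite card_ord.
pose cl x p := ((x + p.-1) %/ p)%N.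
have clP x p : (0 < p)%N -> (x <= cl x p * p)%N.
  move=> p0; have := divn_eq (x + p.-1) p; have := ltn_pmod (x + p.-1) p0.
  by rewrite /cl; lia.
exists (cl #|P| #|I| * cl #|~: P| #|B| + cl #|~: P| #|I| * cl #|P| #|B|)%N.
  have dPQ : [disjoint P & ~: P] by rewrite -setI_eq0 setICr.
  apply: coversD; apply: covers_rect; rewrite ?clP//.
  by rewrite disjoint_sym.
rewrite mulnDl mul2n -addnn leq_add//.
  exact: (@ceil_mul_le #|P| _ _ #|~: P|).
by apply: (@ceil_mul_le #|~: P| _ _ #|P|) => //; rewrite addnC.
Qed.

(** * Four unipotent conjugates of the off-diagonal blocks *)

Section UnipotentConjugates.
Variables (K : numFieldType) (n : nat) (P : {set 'I_n}) (up : 'I_n -> 'I_n).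

(** A weighted matching of [P] with its image under [up]. If that image avoids [P], the matrix
    squares to zero, and adding the identity gives a unipotent conjugator. *)
Definition upmx (w : 'I_n -> K) : 'M[K]_n :=
  \matrix_(i, j) (w i *+ ((i \in P) && (j == up i))).
Definition onemx : 'M[K]_n := blk P (~: P) (const_mx 1).

(** The unweighted matching identifies the blocks of [y] on [P] and on [up @: P]; distinct weights
    make them diagonal; the all-ones block equates the diagonal entries with column sums outside
    [P], hence with each other. [left1] leaves room for one unmatched index, as for odd [n]. *)
Lemma commuting_scalar (w : 'I_n -> K) (y : 'M[K]_n) :
  {in P &, injective up} -> {in P, forall i, up i \notin P} ->
  {in P &, injective w} -> P != set0 ->
  (forall j k, j \notin up @: P :|: P -> k \notin up @: P :|: P -> j = k) ->
  (forall i j, (i \in P) != (j \in P) -> y i j = 0) ->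
  (forall N, N = upmx (fun=> 1) \/ N = upmx w \/ N = onemx ->
    forall i j, i \in P -> j \notin P -> (y *m N) i j = (N *m y) i j) ->
  is_scalar_mx y.
Proof.
move=> up_inj upP w_inj /set0Pn[o oP] left1 y0 yN.
have upL u i j : i \in P -> (upmx u *m y) i j = u i * y (up i) j.
  move=> iP; rewrite mxE (bigD1 (up i))//= big1 => [|k /negPf kup].
    by rewrite addr0 mxE iP eqxx.
  by rewrite mxE kup andbF mul0r.
have upR u i k : k \in P -> (y *m upmx u) i (up k) = y i k * u k.
  move=> kP; rewrite mxE (bigD1 k)//= big1 => [|l lk].
    by rewrite addr0 mxE kP eqxx.
  rewrite mxE; case: (boolP (l \in P)) => [lP|]; last by rewrite mulr0.
  rewrite eq_sym (inj_in_eq up_inj)// (negPf lk) mulr0n mulr0//.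
have upR0 u i j : j \notin up @: P -> (y *m upmx u) i j = 0.
  move=> jP; rewrite mxE big1// => l _; rewrite mxE.
  have [/andP[lP /eqP jl]|_] := boolP (_ && _); last by rewrite mulr0.
  by rewrite jl imset_f in jP.
have oneL i j : i \in P -> (onemx *m y) i j = \sum_(k | k \notin P) y k j.
  move=> iP; rewrite mxE [RHS]big_mkcond; apply: eq_bigr => k _.
  by rewrite !mxE iP inE /=; case: (k \in P); rewrite ?mul0r ?mul1r.
have oneR i j : j \notin P -> (y *m onemx) i j = \sum_(k in P) y i k.
  move=> iP; rewrite mxE [RHS]big_mkcond; apply: eq_bigr => k _.
  by rewrite !mxE inE iP andbT; case: (k \in P); rewrite ?mulr0 ?mulr1.
have F1 i k : i \in P -> k \in P -> y (up i) (up k) = y i k.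
  move=> iP kP; have := yN _ (or_introl erefl) i (up k) iP (upP _ kP).
  by rewrite upL// upR// mulr1 mul1r => ->.
have F1' i j : i \in P -> j \notin up @: P :|: P -> y (up i) j = 0.
  rewrite inE => iP /norP[jup jP].
  have := yN _ (or_introl erefl) i j iP jP.
  by rewrite upL// upR0// mul1r => ->.
have F2 i k : i \in P -> k \in P -> i != k -> y i k = 0.
  move=> iP kP ik.
  have := yN _ (or_intror (or_introl erefl)) i (up k) iP (upP _ kP).
  rewrite upL// upR// F1// mulrC => /eqP; rewrite -subr_eq0 -mulrBl mulf_eq0.
  by rewrite subr_eq0 eq_sym (inj_in_eq w_inj)// (negPf ik) => /eqP.
have F3 i j : i \in P -> j \notin P -> y i i = \sum_(k | k \notin P) y k j.
  move=> iP jP; rewrite -(oneL i)// -yN//; last by right; right.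
  rewrite oneR// (bigD1 i)//= big1 ?addr0// => k /andP[kP ki].
  by rewrite F2// eq_sym.
have outside k j : j \notin P -> (k \notin P) && (k != j) ->
    y k j = if k \in up @: P then 0 else y k j.
  move=> jP /andP[kP kj]; case: ifP => // /imsetP[i iP ki]; rewrite ki.
  case: (boolP (j \in up @: P)) => [/imsetP[l lP jl]|jup].
    rewrite jl F1// F2//; apply: contraNneq kj => il.
    by rewrite ki jl il.
  by apply: F1'; rewrite // inE negb_or jup.
(* Outside [P], column [up l] sums to [y l l] by [F3], which is its diagonal entry by [F1]; the
   remaining entries add to zero, and only row [k] can contribute. *)
have left0 j k : j \in up @: P -> k \notin up @: P :|: P -> y k j = 0.
  move=> /imsetP[l lP ->] kL; have kP : k \notin P.
    by move: kL; rewrite inE => /norP[].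
  have kup : k \notin up @: P by move: kL; rewrite inE => /norP[].
  have klu : k != up l by apply: contraNneq kup => ->; rewrite imset_f.
  have := F3 l (up l) lP (upP _ lP).
  rewrite (bigD1 (up l)) ?upP//= F1// => /eqP.
  rewrite -subr_eq0 opprD addrA subrr add0r oppr_eq0.
  rewrite (bigD1 k) ?kP//= big1 ?addr0 => [/eqP //|m].
  case/andP => mPl mk; rewrite (outside _ _ _ mPl) ?upP//.
  case: ifP => // mup; case/andP: mPl => mP _.
  by rewrite (left1 m k) ?eqxx in mk; rewrite // inE mup.
have off i j : i \notin P -> j \notin P -> i != j -> y i j = 0.
  move=> iP jP ij; rewrite outside ?iP//; case: ifPn => // iup.
  case: (boolP (j \in up @: P)) => jup.
    by rewrite left0// inE (negPf iup).
  by rewrite (left1 i j) ?eqxx ?inE ?(negPf iup) ?(negPf jup) in ij.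
apply/is_scalar_mxP; exists (y o o).
have dQ i : i \notin P -> y i i = y o o.
  move=> iP; rewrite (F3 o i)// (bigD1 i)//= big1 ?addr0// => k /andP[kP ki].
  exact: off.
apply/matrixP => i j; rewrite mxE; case: eqVneq => [<-|ij].
  rewrite mulr1n; case: (boolP (i \in P)) => [iP|/dQ//].
  by rewrite -(F1 i i iP iP); apply/dQ/upP.
rewrite mulr0n; case: (boolP (i \in P)) => iP; case: (boolP (j \in P)) => jP.
- exact: F2.
- by rewrite y0// iP (negPf jP).
- by rewrite y0// jP (negPf iP).
- exact: off.
Qed.

End UnipotentConjugates.

Arguments upmx {K n}.
Arguments onemx {K n}.
Arguments commuting_scalar {K n P up w y}.

(** If [y] is orthogonal to the conjugate under [1 + N], then [(1 - N) y (1 + N)] has no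
    off-diagonal blocks. For [N = 0] this makes [y] block diagonal, so [N y N = 0], and the other
    three [N] give [y N = N y] on the [P * ~: P] block. Thus [y] is scalar, hence orthogonal to
    traceless matrices. *)
Lemma covers_sl (K : numFieldType) n (P : {set 'I_n}) (up : 'I_n -> 'I_n)
    (w : 'I_n -> K) :
  {in P &, injective up} -> {in P, forall i, up i \notin P} ->
  {in P &, injective w} -> P != set0 ->
  (forall j k, j \notin up @: P :|: P -> k \notin up @: P :|: P -> j = k) ->
  covers 4 (suppv K P (~: P) + suppv K (~: P) P) (sl K n).
Proof.
move=> up_inj upP w_inj P0 left1.
(* [None] stands for the zero matrix, that is, for the identity conjugator. *)
pose N (k : option 'I_3) : 'M[K]_n := if k is Some k' then
  [:: upmx P up (fun=> 1); upmx P up w; onemx P]`_k' else 0.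
have Nsupp k i j : ~~ ((i \in P) && (j \notin P)) -> N k i j = 0.
  move=> ij; case: k => [[[|[|[|//]]] ?]|]; rewrite /= mxE//.
  - case: (boolP (_ && _)) => // /andP[iP /eqP jE].
    by rewrite iP jE upP in ij.
  - case: (boolP (_ && _)) => // /andP[iP /eqP jE].
    by rewrite iP jE upP in ij.
  - by rewrite inE (negPf ij).
have NyN k (y : 'M[K]_n) : (forall i j, (i \in P) != (j \in P) -> y i j = 0) ->
    N k *m y *m N k = 0.
  move=> y0; apply/matrixP => i j; rewrite !mxE big1// => l _.
  have [lP|lP] := boolP (l \in P); last by rewrite Nsupp ?(negPf lP) ?mulr0.
  rewrite mxE big1 ?mul0r// => m _.
  have [mP|mP] := boolP (m \in P).
    by rewrite Nsupp ?mP ?andbF ?mul0r.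
  by rewrite [y m l]y0 ?mulr0// lP (negPf mP).
have NN k : N k *m N k = 0.
  have := NyN k 1%:M; rewrite mulmx1; apply=> i j; rewrite mxE.
  by case: (eqVneq i j) => [->|//]; rewrite eqxx.
have gV k : (1%:M + N k) *m (1%:M - N k) = 1%:M.
  rewrite mulmxBr !mulmxDl !mul1mx NN mulmx1 addr0.
  by rewrite addrK.
have gu k : 1%:M + N k \in unitmx by case: (mulmx1_unit (gV k)).
have gi k : invmx (1%:M + N k) = 1%:M - N k.
  by rewrite -[RHS](mulKmx (gu k)) gV mulmx1.
exists (option 'I_3), (fun k => 1%:M + N k); split=> //.
  by rewrite card_option card_ord.
set V := (suppv _ _ _ + _)%VS; apply: subv_trace_orth => y ortho.
have block k i j : (i \in P) != (j \in P) ->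
    ((1%:M - N k) *m y *m (1%:M + N k)) i j = 0.
  move=> ij; set z := _ *m _ *m _.
  have dV : delta_mx j i \in V.
    move: ij; case: (boolP (i \in P)) => iP; case: (boolP (j \in P)) => jP// _.
      apply: (subvP (addvSr _ _)); apply/suppvP => i' j'; rewrite mxE inE.
      by case: eqP => [->|//]; case: eqP => [->|//]; rewrite iP jP.
    apply: (subvP (addvSl _ _)); apply/suppvP => i' j'; rewrite mxE inE.
    by case: eqP => [->|//]; case: eqP => [->|//]; rewrite iP jP.
  have: \tr (y *m conjm (1%:M + N k) (delta_mx j i)) = 0.
    apply: ortho; apply: (subvP (sumv_sup k _ (subvv _))) => //.
    exact: memv_img.
  rewrite conjmE gi !mulmxA mxtrace_mulC !mulmxA -/z mxtrace_mulC.
  rewrite /mxtrace (bigD1 j)//= big1 => [|l /negPf lj]; last first.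
    by rewrite mxE big1// => m _; rewrite mxE lj mul0r.
  rewrite addr0 mxE (bigD1 i)//= big1 => [|l /negPf li]; last first.
    by rewrite mxE li andbF mul0r.
  by rewrite addr0 mxE !eqxx mul1r.
have y0 i j : (i \in P) != (j \in P) -> y i j = 0.
  by move=> /(block None); rewrite /= addr0 subr0 mul1mx mulmx1.
have /is_scalar_mxP[c ->] : is_scalar_mx y.
  apply: (commuting_scalar up_inj upP w_inj P0 left1 y0) => M MN i j iP jP.
  have [k ->] : exists k, M = N k.
    case: MN => [->|[->|->]]; [exists (Some 0)|exists (Some 1)|exists (Some 2)];
      by [].
  have := block k i j; rewrite iP (negPf jP) => /(_ isT).
  rewrite mulmxBl mul1mx mulmxDr mulmx1 mulmxBl NyN// subr0.
  rewrite [LHS]mxE [X in X + _]mxE [X in _ + X + _]mxE.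
  rewrite y0 ?iP ?(negPf jP)// sub0r => /eqP.
  by rewrite addrC subr_eq0 => /eqP.
move=> x; rewrite mem_sl => /eqP trx.
by rewrite mul_scalar_mx mxtraceZ trx mulr0.
Qed.

(** * Pivots of a subspace *)

Section Pivots.
Variables (K : fieldType) (V : vectType K) (T : finType).
Variables (f : T -> 'Hom(V, K^o)) (r : T -> nat).

(** With [f] the matrix entries and [r] an order on positions, these are the pivot positions of an
    echelon basis of [U]. *)
Definition pivots (U : {vspace V}) : {set T} :=
  [set p | `[< exists x, [/\ x \in U, f p x = 1
                          & forall q, (r q < r p)%N -> f q x = 0] >]].

(** [F k] filters [U] by vanishing at all positions of rank below [k]. From [F k] to [F k.+1] the
    dimension drops by at most one, and only when the position of rank [k] is a pivot. *)
Lemma dim_pivots (U : {vspace V}) :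
  injective r -> (forall x, (forall q, f q x = 0) -> x = 0) ->
  (\dim U <= #|pivots U|)%N.
Proof.
move=> r_inj f0.
pose F k := (U :&: \bigcap_(q | (r q < k)%N) lker (f q))%VS.
have FP k x : reflect (x \in U /\ forall q, (r q < k)%N -> f q x = 0) (x \in F k).
  rewrite memv_cap; apply: (iffP andP) => -[xU xk]; split=> //.
    move=> q qk; apply/eqP; rewrite -memv_ker; apply: subvP xk.
    exact: (bigcapv_inf q).
  by apply/subv_bigcapP => q qk; rewrite -memvE memv_ker xk.
have step k : (\dim U <= \dim (F k) + #|[set p in pivots U | (r p < k)%N]|)%N.
  elim: k => [|k IHk].
    apply: leq_trans (leq_addr _ _); apply: dimvS.
    by apply/subvP => x xU; apply/FP; split.
  apply: leq_trans IHk _.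
  have sub : [set p in pivots U | (r p < k)%N]
      \subset [set p in pivots U | (r p < k.+1)%N].
    by apply/subsetP => p; rewrite !inE => /andP[-> /leqW].
  have [p /eqP rp|rk] := pickP (fun p => r p == k); last first.
    rewrite leq_add ?subset_leq_card//; apply: dimvS.
    apply/subvP => x /FP[xU xk]; apply/FP; split=> // q.
    by rewrite ltnS leq_eqVlt rk => /xk.
  have FS x : x \in F k -> f p x = 0 -> x \in F k.+1.
    move=> /FP[xU xk] xp; apply/FP; split=> // q.
    rewrite ltnS leq_eqVlt => /orP[/eqP|/xk//].
    by rewrite -rp => /r_inj ->.
  have [pP|pP] := boolP (p \in pivots U); last first.
    rewrite leq_add ?subset_leq_card//; apply: dimvS.
    apply/subvP => x xF; apply: FS => //; apply/eqP/negPn/negP => xp.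
    case/negP: pP; rewrite inE; apply/asboolP; exists ((f p x)^-1 *: x).
    case/FP: (xF) => xU xk; split; first by rewrite rpredZ.
      by rewrite linearZ /= /GRing.scale /= mulVf.
    by move=> q; rewrite rp => /xk qx; rewrite linearZ /= qx scaler0.
  have lt : (#|[set p in pivots U | (r p < k)%N]|
      < #|[set p in pivots U | (r p < k.+1)%N]|)%N.
    apply: proper_card; rewrite properE sub; apply/subsetPn; exists p.
      by rewrite inE pP rp /=.
    by rewrite inE pP rp ltnn.
  rewrite -(limg_ker_dim (f p) (F k)) -addnA leq_add//.
    apply: dimvS; apply/subvP => x; rewrite memv_cap memv_ker => /andP[xF /eqP].
    exact: FS.
  apply: leq_trans lt; rewrite -add1n leq_add2r.
  by apply: leq_trans (dimvS (subvf _)) _; rewrite dimvf.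
have := step (\max_q r q).+1.
have -> : F (\max_q r q).+1 = 0%VS.
  apply/eqP; rewrite -subv0; apply/subvP => x /FP[_ x0]; rewrite memv0.
  by rewrite (f0 x)// => q; apply: x0; rewrite ltnS leq_bigmax.
rewrite dimv0 add0n => /leq_trans; apply; apply/subset_leq_card/subsetP => p.
by rewrite inE => /andP[].
Qed.

End Pivots.

Arguments pivots {K V T}.
Arguments dim_pivots {K V T}.

(** * Separating sets and the dyadic pigeonhole *)

(** Adjoining [i] to each subset of the complement of [{i, j}] produces [2 ^ (#|T| - 2)] such
    sets. *)
Lemma card_separating (T : finType) (i j : T) : i != j ->
  (2 ^ #|T| <= 4 * #|[set A : {set T} | (i \in A) && (j \notin A)]|)%N.
Proof.
move=> ij; pose C := ~: [set i; j].
have Cc : #|T| = (2 + #|C|)%N by rewrite -(cardsC [set i; j]) cards2 ij.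
rewrite Cc expnD leq_pmul2l// -card_powerset.
have <- : #|[set i |: A | A in powerset C]| = #|powerset C|.
  apply: card_in_imset => A B; rewrite !powersetE => AC BC AB.
  have iC (D : {set T}) : D \subset C -> (i |: D) :\ i = D.
    by move=> DC; apply: setU1K; apply/negP => /(subsetP DC); rewrite !inE eqxx.
  by rewrite -(iC A)// AB iC.
apply/subset_leq_card/subsetP => X /imsetP[A]; rewrite powersetE => AC {X}->.
rewrite !inE eqxx /= negb_or eq_sym ij /=; apply/negP => /(subsetP AC).
by rewrite !inE eqxx orbT.
Qed.

(** Averaging over all [A]: each off-diagonal position is separated by at least a quarter of the
    sets, so some [A] separates a quarter of those in [S]. The diagonal ones, at most [#|T|], are
    lost. *)
Lemma separating_set (T : finType) (S : {set T * T}) :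
  exists A : {set T},
    (#|S| <= #|T| + 4 * #|[set p in S | (p.1 \in A) && (p.2 \notin A)]|)%N.
Proof.
pose c (A : {set T}) := #|[set p in S | (p.1 \in A) && (p.2 \notin A)]|.
pose S' := [set p in S | p.1 != p.2].
have SS' : (#|S| <= #|T| + #|S'|)%N.
  rewrite -(cardsID S' S) addnC leq_add ?subset_leq_card ?subsetIr//.
  have <- : #|[set (x, x) | x : T]| = #|T|.
    by rewrite card_imset// => x y [].
  apply/subset_leq_card/subsetP => -[x y]; rewrite !inE /= => /andP[+ xyS].
  by rewrite xyS negbK => /eqP ->; apply/imsetP; exists y.
have [/existsP[A cA]|/existsPn cA] := boolP [exists A, (#|S'| <= 4 * c A)%N].
  by exists A; apply: leq_trans SS' _; rewrite leq_add2l.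
have : (\sum_A 4 * c A < \sum_(A : {set T}) #|S'|)%N.
  rewrite [X in (_ < X)%N](bigD1 set0)//= (bigD1 set0)//=.
  rewrite -addSn leq_add ?ltnNge ?cA//.
  by apply: leq_sum => A _; apply: ltnW; rewrite ltnNge cA.
have cT : #|{: {set T}}| = (2 ^ #|T|)%N.
  rewrite -[#|T| in RHS]cardsT -card_powerset; apply: eq_card => A.
  by rewrite powersetE subsetT.
rewrite sum_nat_const cT -big_distrr /= ltnNge => /negP[].
have -> : (\sum_A c A =
    \sum_(p in S) #|[set A : {set T} | (p.1 \in A) && (p.2 \notin A)]|)%N.
  under eq_bigr => A _ do rewrite /c -sum1_card.
  under [RHS]eq_bigr => p _ do rewrite -sum1_card.
  rewrite (exchange_big_dep (mem S)) /=; last first.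
    by move=> A p _; rewrite inE => /andP[].
  apply: eq_bigr => p pS; apply: eq_bigl => A; rewrite !inE.
  by rewrite pS.
rewrite mulnC -sum_nat_const big_distrr /=.
rewrite [X in (X <= _)%N](eq_bigl (fun p => (p \in S) && (p.1 != p.2))).
  rewrite big_mkcondr; apply: leq_sum => p pS.
  by case: ifP => // pp; apply: card_separating.
by move=> p; rewrite inE.
Qed.

(** Induction on [L]: if the first alternative holds at [L] and fails at [L.+1], the new index [L]
    brackets [r] within a factor 2 of the threshold [(b %/ 2 ^ k.+1).+1], which is always
    positive. *)
Lemma dyadic_scale b r L :
  (r <= b)%N -> (r * 2 ^ L <= b)%N \/
  exists2 k : 'I_L, (b %/ 2 ^ k.+1 < r)%N & (r <= 2 * (b %/ 2 ^ k.+1).+1)%N.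
Proof.
move=> rb; elim: L => [|L [IHL|[k k1 k2]]]; first by left; rewrite muln1.
  case: (leqP (r * 2 ^ L.+1)%N b) => Lb; [by left | right].
  exists ord_max => /=; first by rewrite ltn_divLR ?expn_gt0.
  have := ltn_ceil b (expn_gt0 2 L.+1); set q := (b %/ _)%N => bq.
  have p0 : (0 < 2 ^ L)%N by rewrite expn_gt0.
  by move: bq; rewrite expnS => bq; nia.
by right; exists (widen_ord (leqnSn L) k).
Qed.

(* Rows with [r i <= b / 2 ^ L] carry less than half of the total, and the
   remaining ones fall into [L] dyadic ranges. *)
Lemma dyadic_pigeonhole (T : finType) (A : {set T}) (r : T -> nat) b L :
  (forall i, i \in A -> (r i <= b)%N) ->
  (2 * (#|A| * b) < 2 ^ L * \sum_(i in A) r i)%N ->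
  exists q (I : {set T}), [/\ (0 < q)%N, I \subset A,
    forall i, i \in I -> (q <= r i)%N &
    (\sum_(i in A) r i <= 4 * L * (q * #|I|))%N].
Proof.
move=> rb big_r; pose q k := (b %/ 2 ^ k.+1).+1.
pose J k := [set i in A | (q k <= r i)%N].
set D := (\sum_(i in A) r i)%N in big_r *.
have [/existsP[k Dk]|/existsPn nk] :=
    boolP [exists k : 'I_L, (D <= 4 * L * (q k * #|J k|))%N].
  exists (q k), (J k); split=> // [|i]; last by rewrite inE => /andP[].
  by apply/subsetP => i; rewrite inE => /andP[].
exfalso.
(* Cleared of denominators: [r i] is at most [b / 2 ^ L] plus twice the sum of the thresholds that
   it reaches. *)
have pointwise i : i \in A ->
    (r i * 2 ^ L <= b + 2 ^ L * \sum_(k < L) (2 * q k) * (q k <= r i))%N.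
  move=> iA; case: (dyadic_scale b (r i) L (rb i iA)) => [/leq_trans|[k k1 k2]].
    by apply; exact: leq_addr.
  apply: leq_trans (leq_addl _ _); rewrite mulnC leq_mul2l; apply/orP; right.
  by rewrite (bigD1 k)//= /q k1 muln1; apply: leq_trans k2 (leq_addr _ _).
have sumD : (2 ^ L * D <= #|A| * b + 2 ^ L * \sum_(k < L) 2 * (q k * #|J k|))%N.
  have -> : (\sum_(k < L) 2 * (q k * #|J k|) =
      \sum_(i in A) \sum_(k < L) (2 * q k) * (q k <= r i))%N.
    rewrite exchange_big /=; apply: eq_bigr => k _.
    rewrite -big_distrr /= mulnA; congr muln.
    rewrite -sum1_card [RHS](eq_bigr (fun i => if (q k <= r i)%N then 1%N else 0%N)).
      by rewrite -big_mkcondr; apply: eq_bigl => i; rewrite inE.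
    by move=> i _; case: (_ <= _)%N.
  rewrite -sum_nat_const !big_distrr /= -big_split /=.
  by apply: leq_sum => i iA; rewrite mulnC; apply: pointwise.
case: (posnP L) => [L0|L0].
  by move: sumD big_r; rewrite L0 big_ord0; lia.
(* Adding the [L] failed bounds shows that the thresholds account for at most half of [D]; [big_r]
   leaves strictly less than the other half to the small rows. *)
have : (L * \sum_(k < L) 4 * (q k * #|J k|) <= L * D)%N.
  rewrite big_distrr /= -[X in (_ <= X * _)%N](card_ord L) -sum_nat_const.
  apply: leq_sum => k _; apply: ltnW.
  by rewrite ltnNge mulnA [(L * 4)%N]mulnC (negPf (nk k)).
rewrite leq_pmul2l// => small.
have : (2 ^ L * \sum_(k < L) 4 * (q k * #|J k|) <= 2 ^ L * D)%N.
  by rewrite leq_mul2l small orbT.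
have -> : (\sum_(k < L) 4 * (q k * #|J k|) = 2 * \sum_(k < L) 2 * (q k * #|J k|))%N.
  by rewrite big_distrr /=; apply: eq_bigr => k _; lia.
move: sumD big_r; set X := (\sum_(k < L) _)%N.
set p := (2 ^ L)%N; lia.
Qed.

(** * Generic changes of basis *)

Lemma vandermonde_eq0 (K : fieldType) b (z : 'rV[K]_b) (rs : seq K) :
  uniq rs -> (b <= size rs)%N ->
  (forall x, x \in rs -> \sum_(c < b) z 0 c * x ^+ c = 0) -> z = 0.
Proof.
move=> urs brs z0; rewrite -[z]rVpolyK (_ : rVpoly z = 0) ?linear0//.
apply: (@roots_geq_poly_eq0 _ _ rs) => //.
  apply/allP => x /z0 zx; apply/rootP.
  rewrite (horner_coef_wide _ (size_poly _ _)) -[RHS]zx.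
  by apply: eq_bigr => c _; rewrite coef_rVpoly_ord.
exact: leq_trans (size_poly _ _) brs.
Qed.

Lemma row_full_tr_free (K : fieldType) r b (M : 'M[K]_(r, b)) :
  row_free M^T -> row_full M.
Proof. by rewrite /row_free /row_full mxrank_tr. Qed.

Definition evmx {K : fieldType} {r b} (t : K) (F : 'M[{poly K}]_(r, b)) :=
  map_mx (horner_eval t) F.

(** A maximal minor that is nonzero at [t0] is a nonzero polynomial in [t], and the rank stays full
    wherever this minor does not vanish. *)
Lemma row_full_specialization (K : fieldType) r b (F : 'M[{poly K}]_(r, b)) t0 :
  row_full (evmx t0 F) ->
  exists2 p : {poly K}, p != 0 & forall t, p.[t] != 0 -> row_full (evmx t F).
Proof.
move=> full; pose f := fullrankfun full.
have detE t : (\det (rowsub f F)).[t] = \det (rowsub f (evmx t F)).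
  rewrite -[LHS]/(horner_eval t _) -det_map_mx.
  by congr (\det _); apply/matrixP => i j; rewrite !mxE.
exists (\det (rowsub f F)) => [|t].
  apply/eqP => d0; have := detE t0; rewrite d0 horner0 => /esym/eqP.
  apply/negP; rewrite -unitfE -unitmxE -row_full_unit.
  exact: fullrowsub_full.
rewrite detE -unitfE -unitmxE -row_full_unit => full'.
rewrite -sub1mx; apply: submx_trans (_ : (rowsub f (evmx t F) <= _)%MS).
  by rewrite sub1mx.
exact: rowsub_sub.
Qed.

Lemma nonroot (K : numFieldType) (p : {poly K}) : p != 0 -> exists t, p.[t] != 0.
Proof.
move=> p0; apply: contrapT => noroot; case/negP: p0; apply/eqP.
apply: (@roots_geq_poly_eq0 _ _ [seq i%:R | i <- iota 0 (size p)]).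
- apply/allP => x _; apply/rootP/eqP/negPn/negP => px.
  by apply: noroot; exists x.
- by rewrite map_inj_uniq ?iota_uniq// => i j /eqP; rewrite eqr_nat => /eqP.
- by rewrite size_map size_iota.
Qed.

(* The matrices [h k] are Vandermonde on [B], with pairwise distinct nodes over
   all rows of all [k], after rescaling row [l] by [t ^ l]: as [t] tends to 0
   the echelon rows [v i j] degenerate to basis vectors, for which the spanning
   property is that of Vandermonde minors. *)
Lemma generic_span (K : numFieldType) n m (B I : {set 'I_n})
    (S : 'I_n -> {set 'I_n}) (v : 'I_n -> 'I_n -> 'I_n -> K) :
  (forall i, i \in I -> S i \subset B) ->
  (forall i, i \in I -> (#|B| <= m * #|S i|)%N) ->
  (forall i j, i \in I -> j \in S i ->
     [/\ forall l, l \notin B -> v i j l = 0, v i j j = 1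
       & forall l : 'I_n, (l < j)%N -> v i j l = 0]) ->
  exists h : 'I_m -> 'M[K]_n,
    [/\ forall k, h k \in unitmx,
        forall k l c, ~~ ((l \in B) && (c \in B)) -> h k l c = (l == c)%:R
      & forall i, i \in I -> forall u : 'I_n -> K,
          (forall c, c \notin B -> u c = 0) ->
          exists a : 'I_m -> 'I_n -> K, forall c,
            u c = \sum_k \sum_(j in S i) a k j * \sum_l v i j l * h k l c].
Proof.
move=> SB mS vP.
(* Base-[n] encoding of the pair, so that all nodes are distinct in characteristic zero. *)
pose node (k : 'I_m) (l : 'I_n) : K := (k * n + l)%:R.
have node_inj k k' l l' : node k l = node k' l' -> (k, l) = (k', l').
  move=> /eqP; rewrite eqr_nat => /eqP e.
  have := congr1 (modn^~ n) e; rewrite !modnMDl !modn_small// => el.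
  move: e; rewrite el => /addIn/eqP; rewrite eqn_pmul2r; last first.
    by apply: leq_ltn_trans (ltn_ord l).
  by move=> /eqP ek; congr (_, _); apply: val_inj.
pose h t k : 'M[K]_n := \matrix_(l, c) (if (l \in B) && (c \in B)
  then t ^+ l * node k l ^+ index c (enum B) else (l == c)%:R).
have indexE (c : 'I_#|B|) : index (enum_val c) (enum B) = c.
  by rewrite (enum_val_nth (enum_val c)) index_uniq ?enum_uniq// -cardE.
have sumB (x : K) (y : 'I_n -> K) :
    \sum_(c in B) y c * x ^+ index c (enum B)
    = \sum_(c < #|B|) y (enum_val c) * x ^+ c.
  by rewrite big_enum_val; apply: eq_bigr => c _; rewrite indexE.
have hU t k : t != 0 -> h t k \in unitmx.
  move=> t0; rewrite -unitmx_tr -row_free_unit; apply: inj_row_free => y yh.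
  have eqn l : \sum_c y 0 c * h t k l c = 0.
    have := congr1 (fun M : 'rV_n => M 0 l) yh; rewrite !mxE => {2}<-.
    by apply: eq_bigr => c _; rewrite !mxE.
  have yC l : l \notin B -> y 0 l = 0.
    move=> lB; have := eqn l; rewrite (bigD1 l)//= big1 => [|c cl].
      by rewrite addr0 mxE (negPf lB) eqxx mulr1.
    by rewrite mxE (negPf lB) eq_sym (negPf cl) mulr0.
  have z0 : \row_(c < #|B|) y 0 (enum_val c) = 0.
    apply: (@vandermonde_eq0 _ _ _ [seq node k l | l <- enum B]).
    - rewrite map_inj_uniq ?enum_uniq// => l l' /node_inj[] //.
    - by rewrite size_map -cardE.
    move=> x /mapP[l]; rewrite mem_enum => lB ->.
    under eq_bigr => c _ do rewrite mxE.
    rewrite -(sumB _ (fun c => y 0 c)).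
    apply/eqP; rewrite -(mulrI_eq0 _ (mulfI (expf_neq0 l t0))); apply/eqP.
    rewrite -[RHS](eqn l) big_distrr /= big_mkcond /=; apply: eq_bigr => c _.
    rewrite mxE lB /=; case: ifPn => [_|/yC ->]; first by ring.
    by rewrite mul0r.
  apply/rowP => l; rewrite mxE; case: (boolP (l \in B)) => [lB|/yC//].
  have := congr1 (fun M : 'rV_ _ => M 0 (enum_rank_in lB l)) z0.
  by rewrite !mxE enum_rankK_in.
pose T := ('I_m * 'I_n)%type.
(* Row [(k, j)] is the image of [v i j] under [h t k] divided by [t ^ j]; the truncated [l - j] is
   harmless since [v i j l] vanishes for [l < j]. At [t = 0] only [l = j] survives and leaves the
   Vandermonde row of [node k j]. *)
pose F i : 'M[{poly K}]_(#|{: T}|, #|B|) := \matrix_(r, c)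
  let: (k, j) := enum_val r in
  if j \in S i then \sum_l (v i j l * node k l ^+ c) *: 'X^(l - j) else 0.
have FE i t k j c : j \in S i -> evmx t (F i) (enum_rank (k, j)) c =
    \sum_l v i j l * node k l ^+ c * t ^+ (l - j).
  move=> jS; rewrite !mxE enum_rankK jS /horner_eval horner_sum.
  by apply: eq_bigr => l _; rewrite hornerZ hornerXn.
have F0 i : i \in I -> row_full (evmx 0 (F i)).
  move=> iI; apply/row_full_tr_free/inj_row_free => y yF.
  apply: (@vandermonde_eq0 _ _ _ [seq node k j | k <- enum 'I_m, j <- enum (S i)]).
  - rewrite allpairs_uniq ?enum_uniq// => -[k j] [k' j'] _ _ /= /node_inj.
    by [].
  - by rewrite size_allpairs -!cardE card_ord mS.
  move=> x /allpairsP[[k j] /= [_]]; rewrite mem_enum => jS ->.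
  have := congr1 (fun M : 'rV_ _ => M 0 (enum_rank (k, j))) yF.
  rewrite !mxE => {2}<-; apply: eq_bigr => c _; congr (_ * _).
  have [_ vj v0] := vP i j iI jS.
  rewrite mxE FE// (bigD1 j)//= big1 => [|l lj].
    by rewrite addr0 vj mul1r subnn expr0 mulr1.
  case: (ltngtP l j) => [/v0 ->|jl|/val_inj lj']; first by rewrite !mul0r.
    by rewrite expr0n subn_eq0 leqNgt jl mulr0.
  by rewrite lj' eqxx in lj.
have /choice[p pP] : forall i, exists p : {poly K}, p != 0 /\
    (i \in I -> forall t, p.[t] != 0 -> row_full (evmx t (F i))).
  move=> i; have [/F0/row_full_specialization[p p0 pF]|iI] := boolP (i \in I).
    by exists p.
  by exists 1; split; first exact: oner_neq0.
(* A single [t] serves all rows [i]; the factor ['X] makes it nonzero, as needed to invert [h t k]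
   and to divide by [t ^ j]. *)
have [t] : exists t, ('X * \prod_i p i).[t] != 0.
  apply: nonroot; rewrite mulf_neq0 ?polyX_eq0//; apply/prodf_neq0 => i _.
  by case: (pP i).
rewrite hornerM hornerX mulf_eq0 negb_or => /andP[t0 pt].
exists (h t); split=> [k|k l c lc|i iI u u0]; first exact: hU.
  by rewrite mxE (negPf lc).
have /submx_full Ft : row_full (evmx t (F i)).
  apply: (proj2 (pP i) iI); apply: contra pt => /eqP pi.
  by rewrite horner_prod (bigD1 i)//= pi mul0r.
have /submxP[D uD] := Ft _ (\row_(c < #|B|) u (enum_val c)).
exists (fun k j => D 0 (enum_rank (k, j)) / t ^+ j) => c.
have [cB|cB] := boolP (c \in B); last first.
  rewrite u0// big1// => k _; rewrite big1// => j jS.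
  have [vB _ _] := vP i j iI jS.
  rewrite big1 ?mulr0// => l _; rewrite mxE (negPf cB) andbF.
  by case: eqP => [->|_]; rewrite ?mulr0 ?vB ?mul0r.
have := congr1 (fun M : 'rV_ _ => M 0 (enum_rank_in cB c)) uD.
rewrite !mxE enum_rankK_in// => ->.
rewrite (reindex (@enum_rank T)) /=; last first.
  by apply: onW_bij; apply: enum_rank_bij.
under [RHS]eq_bigr => k _ do rewrite big_mkcond.
rewrite [RHS]pair_bigA; apply: eq_bigr => -[k j] _ /=.
have [jS|jS] := boolP (j \in S i); last first.
  by rewrite !mxE enum_rankK (negPf jS) /horner_eval horner0 mulr0.
rewrite FE// -mulrA; congr (_ * _); rewrite big_distrr /=.
have [vB _ v0] := vP i j iI jS.
have cE : index c (enum B) = enum_rank_in cB c.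
  by rewrite -{1}(enum_rankK_in cB cB) indexE.
apply: eq_bigr => l _; rewrite mxE cB andbT.
have [lB|/vB ->] := boolP (l \in B); last by rewrite !mul0r mulr0.
have [/v0 ->|jl] := ltnP l j; first by rewrite !mul0r mulr0.
rewrite cE -{2}(subnK jl) exprD; field.
by rewrite expf_neq0.
Qed.

(** * From pivots to a full block and to [sl_n] *)

(** Three conjugates isolate the [A * ~: A] block, [m] changes of basis make each row [i] in [I]
    arbitrary with zero rows above it, and forward substitution prescribes all these rows at once;
    two more conjugates discard the other rows. *)
Lemma covers_leading_rows (K : numFieldType) n m (A I : {set 'I_n})
    (S : 'I_n -> {set 'I_n}) (U : {vspace 'M[K]_n}) :
  I \subset A -> (forall i, i \in I -> S i \subset ~: A) ->
  (forall i, i \in I -> (#|~: A| <= m * #|S i|)%N) ->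
  (forall i j, i \in I -> j \in S i -> exists x, [/\ x \in U, x i j = 1,
     forall k l : 'I_n, (k < i)%N -> x k l = 0
     & forall l : 'I_n, (l < j)%N -> x i l = 0]) ->
  covers (3 * m * 2) U (suppv K I (~: A)).
Proof.
move=> IA SB mS lead; set B := ~: A.
have /choice[X XP] : forall p : 'I_n * 'I_n, exists x : 'M[K]_n,
    p.1 \in I -> p.2 \in S p.1 -> [/\ x \in U, x p.1 p.2 = 1,
     forall k l : 'I_n, (k < p.1)%N -> x k l = 0
     & forall l : 'I_n, (l < p.2)%N -> x p.1 l = 0].
  move=> [i j] /=; have [iI|_] := boolP (i \in I); last by exists 0.
  have [jS|_] := boolP (j \in S i); last by exists 0.
  by have [x xP] := lead i j iI jS; exists x.
pose Y i j := blk A B (X (i, j)).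
have YE i j k l : Y i j k l = X (i, j) k l *+ ((k \in A) && (l \in B)).
  by rewrite mxE.
have [||i j iI jS|h [hU hB hspan]] := @generic_span K n m B I S
    (fun i j l => Y i j i l).
- exact: SB.
- exact: mS.
- have [/= _ x1 _ xl] := XP (i, j) iI jS; have iA := subsetP IA i iI.
  split=> [l lB||l lj]; rewrite YE.
  + by rewrite (negPf lB) andbF.
  + by rewrite iA (subsetP (SB i iI) j jS) x1.
  + by rewrite xl// mul0rn.
pose U1 := (linfun (blk A B) @: U)%VS.
(* [h k] is the identity on [A], so left multiplication by it fixes such an [x], and only the right
   factor acts. *)
have conjh k x : x \in suppv K A B -> conjm (invmx (h k)) x = x *m h k.
  move=> /suppvP xAB; apply: conjm_eq; rewrite ?unitmx_inv// mulmxK//.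
  rewrite -[RHS](mulKmx (hU k)); congr (_ *m _); apply/matrixP => r c.
  rewrite mxE (bigD1 r)//= big1 => [|l lr].
    rewrite addr0; have [rA|rA] := boolP (r \in A).
      by rewrite hB ?eqxx ?mul1r// !inE rA.
    by rewrite [x r c]xAB ?mulr0// (negPf rA).
  have [lA|lA] := boolP (l \in A).
    by rewrite hB ?inE ?lA ?andbF// eq_sym (negPf lr) mul0r.
  by rewrite [x l c]xAB ?mulr0// (negPf lA).
pose W := (\sum_k conjm (invmx (h k)) @: U1)%VS.
have U1W : covers m U1 W.
  exists 'I_m, (fun k => invmx (h k)); split=> //; first by rewrite card_ord.
  by move=> k; rewrite unitmx_inv.
have U1AB x : x \in U1 -> x \in suppv K A B.
  by case/memv_imgP=> y _ ->; rewrite memv_img ?memvf.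
have YU i j : i \in I -> j \in S i -> Y i j \in U1.
  move=> iI jS; have [/= XU _ _ _] := XP (i, j) iI jS.
  by apply/memv_imgP; exists (X (i, j)); rewrite // lfunE.
have leadW i u : i \in I -> (forall c, c \notin B -> u c = 0) ->
    exists w, [/\ w \in W, forall c, w i c = u c
      & forall k c : 'I_n, (k < i)%N -> w k c = 0].
  move=> iI u0; have [a aP] := hspan i iI u u0.
  exists (\sum_k \sum_(j in S i) a k j *: conjm (invmx (h k)) (Y i j)); split.
  - apply: memv_sumr => k _; apply: rpred_sum => j jS.
    by apply/rpredZ/memv_img/YU.
  - move=> c; rewrite aP summxE; apply: eq_bigr => k _; rewrite summxE.
    apply: eq_bigr => j jS; rewrite mxE conjh; last exact/U1AB/YU.
    by rewrite mxE.
  - move=> k c ki; rewrite summxE big1// => k' _; rewrite summxE big1// => j jS.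
    rewrite mxE conjh; last exact/U1AB/YU.
    rewrite mxE big1 ?mulr0// => l _; rewrite YE.
    by have [/= _ _ -> //] := XP (i, j) iI jS; rewrite mul0rn mul0r.
apply: covers_trans (_ : covers _ W _).
  exact: covers_trans (covers_blk _ _ A U) U1W.
have WAB : (W <= suppv K A B)%VS.
  apply/subv_sumP => k _; apply/subvP => _ /memv_imgP[x /U1AB xAB ->].
  rewrite conjh//; move/suppvP: xAB => xAB; apply/suppvP => r c rc.
  rewrite mxE big1// => l _.
  have [rA|rA] := boolP (r \in A); last by rewrite xAB ?mul0r// (negPf rA).
  have [cB|cB] := boolP (c \in B); first by rewrite rA cB in rc.
  rewrite hB ?(negPf cB) ?andbF//; case: eqP => [->|_]; last by rewrite mulr0.
  by rewrite xAB ?mul0r// (negPf cB) andbF.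
apply: covers_rows => // z /suppvP zI.
(* Rows are corrected in increasing order: the element adjusting row [i] vanishes on all rows before
   it. *)
have fill i0 : exists2 w, w \in W &
    forall i j : 'I_n, i \in I -> (i < i0)%N -> w i j = z i j.
  elim: i0 => [|i0 [w wW wz]]; first by exists 0; rewrite ?mem0v.
  have [/existsP[i /andP[iI /eqP ii0]]|/existsPn no] :=
      boolP [exists i : 'I_n, (i \in I) && (i == i0 :> nat)]; last first.
    exists w => // i j iI; rewrite ltnS leq_eqVlt => /orP[ii0|]; last exact: wz.
    by have := no i; rewrite iI ii0.
  have [c cB|w' [w'W w'i w'0]] := @leadW i (fun c => z i c - w i c) iI.
    have /suppvP wAB := subvP WAB w wW.
    by rewrite zI ?wAB ?subr0// (negPf cB) andbF.
  exists (w + w'); first exact: rpredD.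
  move=> r j rI; rewrite ltnS leq_eqVlt => /orP[/eqP ri|ri]; rewrite mxE.
    have -> : r = i by apply: val_inj; rewrite /= ri ii0.
    by rewrite w'i addrC subrK.
  by rewrite w'0 ?ii0// addr0 wz.
by have [w wW wz] := fill n; exists w => // i j iI; apply: wz.
Qed.

Definition entry {K : fieldType} {n} (p : 'I_n * 'I_n) (x : 'M[K]_n) : K^o :=
  x p.1 p.2.

Fact entry_is_linear (K : fieldType) n (p : 'I_n * 'I_n) :
  linear (@entry K n p).
Proof. by move=> a x y; rewrite /entry !mxE. Qed.

HB.instance Definition _ (K : fieldType) n (p : 'I_n * 'I_n) :=
  GRing.isLinear.Build K 'M[K]_n K^o *:%R (entry p) (@entry_is_linear K n p).

Lemma covers_sl_half (K : numFieldType) n (P := [set i : 'I_n | (i < n./2)%N]) :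
  (1 < n)%N -> covers 4 (suppv K P (~: P) + suppv K (~: P) P) (sl K n).
Proof.
move=> n1; set a := n./2 in P *.
have nE : n = (odd n + a.*2)%N by rewrite odd_double_half.
pose up (i : 'I_n) := insubd i (i + a)%N.
have upE i : i \in P -> up i = (i + a)%N :> nat.
  rewrite inE => ia; rewrite val_insubd ifT//.
  by clear -ia nE; lia.
apply: (@covers_sl K n P up (fun i => i%:R)).
- move=> i k iP kP /(congr1 (@nat_of_ord n)).
  by rewrite !upE// => /addIn/val_inj.
- by move=> i iP; rewrite inE upE// -leqNgt leq_addl.
- by move=> i k _ _ /eqP; rewrite eqr_nat => /eqP/val_inj.
- have n0 : (0 < n)%N by exact: ltnW.
  apply/set0Pn; exists (Ordinal n0); rewrite inE /= half_gt0//.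
(* For even [n] nothing is left unmatched, for odd [n] only the last index. *)
suff out j : j \notin up @: P :|: P -> j = a.*2 :> nat.
  by move=> j k /out ja /out ka; apply: val_inj; rewrite /= ja ka.
rewrite !inE negb_or -leqNgt => /andP[jup aj].
apply/eqP; rewrite eqn_leq; apply/andP; split.
  by have := ltn_ord j; have := leq_b1 (odd n); clear -nE; lia.
rewrite leqNgt; apply: contra jup => ja; apply/imsetP.
have jn : (j - a < n)%N by apply: leq_ltn_trans (leq_subr _ _) (ltn_ord j).
have jP : Ordinal jn \in P by rewrite inE /=; lia.
by exists (Ordinal jn) => //; apply: val_inj; rewrite /= upE//= subnK.
Qed.

(** The count is [24 m N4]. Since [m q <= 2 b] and [N4 p b <= 2 n ^ 2], it is at most
    [96 n ^ 2 / (p q)], while [dim U - n <= 4 #|S'| <= 16 L p q]; hence [1536 = 96 * 16]. *)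
Lemma covers_sl_of_dim (K : numFieldType) n L (U : {vspace 'M[K]_n}) :
  (1 < n)%N -> (2 * (n * n) < 2 ^ L * (\dim U - n))%N ->
  exists2 N, covers N U (sl K n) &
    (N * (\dim U - n) <= 1536 * L * (n * n))%N.
Proof.
move=> n1 bigU; set d := \dim U in bigU *.
(* Row-major rank: an element leading at a pivot has zero rows above it. *)
pose r (p : 'I_n * 'I_n) := (p.1 * n + p.2)%N.
have r_inj : injective r.
  move=> [i j] [k l]; rewrite /r /= => e.
  have := congr1 (modn^~ n) e; rewrite !modnMDl !modn_small// => el.
  move: e; rewrite el => /addIn/eqP; rewrite eqn_pmul2r; last exact: ltnW.
  by move=> /eqP ek; congr (_, _); apply: val_inj.
pose f (p : 'I_n * 'I_n) : 'Hom('M[K]_n, K^o) := linfun (entry p).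
pose Piv := pivots f r U.
have dPiv : (d <= #|Piv|)%N.
  apply: dim_pivots r_inj _ => x x0; apply/matrixP => i j.
  by have := x0 (i, j); rewrite lfunE mxE.
have [A] := separating_set _ Piv; set S' := [set p in Piv | _].
rewrite card_ord => cA.
have {cA dPiv} dD : (d - n <= 4 * #|S'|)%N.
  by rewrite leq_subLR; exact: leq_trans cA.
move: dD bigU; set e : nat := (d - n)%N => dD bigU.
pose S i := [set j | (i, j) \in S'].
have S'E : (\sum_(i in A) #|S i| = #|S'|)%N.
  rewrite -sum1_card (eq_bigl (fun p : 'I_n * 'I_n =>
      (p.1 \in A) && (p.2 \in S p.1))); last first.
    by move=> [i j]; rewrite !inE /=; case: (i \in A); rewrite ?andbF.
  rewrite -(pair_big_dep (mem A) (fun i j => j \in S i) (fun _ _ => 1%N)) /=.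
  by apply: eq_bigr => i _; rewrite sum1_card.
have SB i : S i \subset ~: A.
  by apply/subsetP => j; rewrite !inE /= => /and3P[].
have ABn : (#|A| + #|~: A| = n)%N by rewrite cardsC card_ord.
have [||q [I [q0 IA qS bigI]]] :=
    @dyadic_pigeonhole 'I_n A (fun i => #|S i|) #|~: A| L.
- by move=> i _; apply: subset_leq_card.
(* The bound [4 #|A| #|~: A| <= n ^ 2] compensates the factor 4 lost in [dD]. *)
- rewrite S'E; have : (4 * (#|A| * #|~: A|) <= n * n)%N.
    by move: ABn; move: #|A| #|~: A| => x y <-; rewrite mulnn; exact: nat_AGM2.
  have : (2 ^ L * e <= 2 ^ L * (4 * #|S'|))%N by rewrite leq_mul2l dD orbT.
  by move: bigU; clear; move: (2 ^ L)%N #|A| #|~: A| #|S'| => p x y D; nia.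
rewrite S'E in bigI; set b := #|~: A| in ABn.
have e0 : (0 < e)%N.
  by rewrite lt0n; apply: contraTneq bigU => ->; rewrite muln0.
have I0 : (0 < #|I|)%N.
  rewrite lt0n; apply: contraTneq bigI => ->; rewrite !muln0 -ltnNge.
  by move: dD e0; clear; lia.
have qb : (q <= b)%N.
  have /card_gt0P[i iI] := I0; apply: leq_trans (qS i iI) _.
  exact: subset_leq_card.
(* The ceiling of [b / q], at most [2 b / q] because [q <= b]. *)
pose m := ((b + q.-1) %/ q)%N.
have bm : (b <= m * q)%N.
  have := divn_eq (b + q.-1) q; have := ltn_pmod (b + q.-1) q0.
  by rewrite -/m; clear -q0; lia.
have mb : (m * q <= 2 * b)%N.
  by have := leq_divM (b + q.-1) q; rewrite -/m; clear -qb q0; lia.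
have cov1 : covers (3 * m * 2) U (suppv K I (~: A)).
  apply: (@covers_leading_rows K n m A I S) => // [i iI|i j iI].
    by apply: leq_trans bm _; rewrite leq_mul2l qS// orbT.
  rewrite inE => /setIdP[+ _]; rewrite inE => /asboolP[x [xU xij x0]].
  exists x; split=> // [|k l ki|l lj].
  - by rewrite -xij lfunE.
  - have := x0 (k, l); rewrite lfunE; apply.
    rewrite /r /=; have := ltn_ord l; have := ltn_ord j; clear -ki; nia.
  - by have := x0 (i, l); rewrite lfunE; apply; rewrite /r /= ltn_add2l.
set P := [set i : 'I_n | (i < n./2)%N].
have cP : #|P| = n./2.
  rewrite -sum1_card (eq_bigl (fun i : 'I_n => i < n./2)%N) => [|i]; last first.
    by rewrite inE.
  rewrite -(big_ord_widen n (fun=> 1%N)) ?sum1_card ?card_ord//.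
  by clear; lia.
have cQ : #|~: P| = (n - n./2)%N by rewrite -cP cardsCs setCK card_ord.
have [|||||||N4 cov4 N4b] := @covers_square K n I (~: A) P.
- by rewrite -subsets_disjoint.
- exact: I0.
- exact: leq_trans qb.
- by rewrite cP; clear -n1; lia.
- by rewrite cQ; clear -n1; lia.
- by rewrite cP cQ; clear; lia.
- by rewrite cP cQ; clear; lia.
exists (3 * m * 2 * N4 * 4)%N.
  apply: covers_trans (covers_trans _ _ _ _ _ _ _ cov1 cov4) _.
  exact: covers_sl_half.
have b0 : (0 < b)%N by exact: leq_trans qb.
rewrite -/b in N4b; set p := #|I| in bigI N4b *.
have NpqE : (3 * m * 2 * N4 * 4 * (p * q) <= 96 * (n * n))%N.
  rewrite -(leq_pmul2r b0).
  have : (m * q * (N4 * (p * b)) <= 2 * b * (2 * (n * n)))%N by exact: leq_mul.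
  clear; lia.
apply: leq_trans (_ : 3 * m * 2 * N4 * 4 * (4 * (4 * L * (q * p))) <= _)%N.
  rewrite leq_mul2l; apply/orP; right; apply: leq_trans dD _.
  by rewrite leq_mul2l bigI orbT.
have : (16 * L * (3 * m * 2 * N4 * 4 * (p * q)) <= 16 * L * (96 * (n * n)))%N.
  by rewrite leq_mul2l NpqE orbT.
clear; lia.
Qed.

(** * From [GL_n] to [SL_n], and the bound in epsilon *)

Lemma conjmZ (K : fieldType) n (c : K) (g : 'M[K]_n) :
  c != 0 -> g \in unitmx -> conjm (c *: g) = conjm g.
Proof.
move=> c0 ug; apply/lfunP => x.
have ucg : c *: g \in unitmx by rewrite unitmxZ ?unitfE.
by apply: conjm_eq; rewrite // -scalemxAl -scalemxAr conjmE mulmxKV.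
Qed.

(** Conjugation ignores scalars, so [g] may be multiplied by an [n]-th root of the inverse of its
    determinant. *)
Lemma SL_normalization (K : numClosedFieldType) n (g : 'M[K]_n) :
  (0 < n)%N -> g \in unitmx -> exists s : SL K n, conjm s = conjm g.
Proof.
move=> n0 ug; have d0 : \det g != 0 by rewrite -unitfE -unitmxE.
pose c := n.-root (\det g)^-1.
have cn : c ^+ n = (\det g)^-1 by rewrite rootCK.
have c0 : c != 0 by have := invr_neq0 d0; rewrite -cn expf_eq0 n0.
have det1 : \det (c *: g) == 1 by rewrite detZ cn mulVf.
by exists (MkSL det1); apply: conjmZ.
Qed.

Definition sl_incl (K : fieldType) n : 'Hom(sl_type K n, 'M[K]_n) :=
  linfun vsval.

Lemma sl_incl_inj (K : fieldType) n : injective (sl_incl K n).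
Proof. by move=> x y; rewrite !lfunE => /val_inj. Qed.

Lemma translates_span_covers (K : numClosedFieldType) n N
    (U : {vspace sl_type K n}) :
  (0 < n)%N -> covers N (sl_incl K n @: U)%VS (sl K n) ->
  exists2 d, (d <= N)%N & translates_span (sl_rep K n) U d.
Proof.
move=> n0 [T [g [TN gu gsl]]].
have /choice[s sg] t := SL_normalization K n (g t) n0 (gu t).
exists #|T| => //; exists (fun i => s (enum_val i)); set Z := (\sum_i _)%VS.
have ZE : (sl_incl K n @: Z = \sum_t (conjm (g t) @: (sl_incl K n @: U)))%VS.
  rewrite limg_sum (reindex (@enum_val T predT)) /=; last first.
    by apply: onW_bij; apply: enum_val_bij.
  apply: eq_bigr => i _; rewrite -!limg_comp; congr lfun_img.
  apply/lfunP => x; rewrite !comp_lfunE -sg conjmE.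
  by rewrite /sl_incl !lfunE.
apply/eqP; rewrite eqEsubv subvf /=; apply/subvP => x _.
have : sl_incl K n x \in (sl_incl K n @: Z)%VS.
  by rewrite ZE; apply: (subvP gsl); rewrite lfunE subvsP.
by case/memv_imgP => z zZ /sl_incl_inj ->.
Qed.
Lemma pow2_ceil_log2 (R : realType) (x : R) : 1 < x ->
  exists2 L : nat, (Num.ceil (log2 x))%:~R = L%:R :> R & x <= 2 ^+ L.
Proof.
move=> x1; have ln2 : 0 < ln (2 : R) by rewrite ln_gt0// ltr1n.
set c := Num.ceil _; have c0 : 0 <= c.
  by rewrite ceil_ge0 (lt_trans (ltrN10 R))// divr_gt0// ln_gt0.
have cL : c%:~R = (absz c)%:R :> R by rewrite -[in LHS](gez0_abs c0).
exists (absz c) => //; rewrite -(lnK (x := x)) ?posrE; last exact: lt_trans x1.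
rewrite -(lnK (x := 2 ^+ _)) ?posrE ?exprn_gt0// ler_expR lnXn//.
rewrite -[leRHS]mulr_natl -ler_pdivrMr// -cL; exact: Num.Theory.ceil_ge.
Qed.

Theorem proposition1p7 (R : realType) (eps : R) (n : nat)
    (eps_gt0 : 0 < eps) (eps_lt : eps < 1 / 3)
    (n_ge : Num.max 9 (2 / eps) <= n%:R)
    (U : {vspace sl_type R[i] n}) (dimU : eps * n%:R ^+ 2 < (\dim U)%:R) :
  (diam_add R (sl_rep R[i] n) U
     <= (3456 / eps * (Num.ceil (log2 (4 / eps)))%:~R)%:E)%E.
Proof.
have [n9 n2] : 9 <= n%:R :> R /\ 2 / eps <= n%:R.
  by move: n_ge; rewrite ge_max => /andP[].
have n_gt1 : (1 < n)%N by rewrite -(ltr_nat R); lra.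
have n_eps : 2 <= eps * n%:R by move: n2; rewrite ler_pdivrMr// mulrC.
have q0 : 1 < 4 / eps by rewrite ltr_pdivlMr// mul1r; lra.
have [L cL powL] := pow2_ceil_log2 _ _ q0.
pose U0 := (sl_incl R[i] n @: U)%VS.
have dimU0 : \dim U0 = \dim U.
  apply: limg_dim_eq; apply/eqP; rewrite -subv0; apply/subvP => x.
  rewrite memv_cap memv_ker memv0 => /andP[_ /eqP x0]; apply/eqP.
  by apply: sl_incl_inj; rewrite x0 linear0.
(* As [n >= 2 / eps], the loss of [n] diagonal positions costs at most half of [eps * n ^ 2]. *)
have nn : n%:R <= eps * n%:R ^+ 2 / 2.
  by have := ler_wpM2r (ler0n R n) n_eps; rewrite expr2; lra.
have nU : (n <= \dim U)%N by rewrite -(ler_nat R); lra.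
have dimB : eps * n%:R ^+ 2 / 2 < (\dim U - n)%:R by rewrite natrB//; lra.
have big : (2 * (n * n) < 2 ^ L * (\dim U - n))%N.
  rewrite -(ltr_nat R) !natrM natrX.
  have : 4 / eps * (eps * n%:R ^+ 2 / 2) < 2 ^+ L * (\dim U - n)%:R.
    apply: le_lt_trans (ler_wpM2r _ powL) _; first by lra.
    by rewrite ltr_pM2l ?exprn_gt0.
  apply: le_lt_trans; rewrite le_eqVlt; apply/orP; left; apply/eqP.
  by field; lra.
have := covers_sl_of_dim R[i] n L U0 n_gt1; rewrite dimU0 => /(_ big)[N cov NL].
have [d dN span] := translates_span_covers _ _ _ _ (ltnW n_gt1) cov.
rewrite /diam_add; case: pselect => [h|[]]; last by exists d.
rewrite lee_fin cL; case: ex_minnP => m _ /(_ d) mmin.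
have md : (m <= N)%N by apply: leq_trans dN; apply/mmin/asboolP.
apply: le_trans (_ : N%:R <= _); first by rewrite ler_nat.
have nsq : 0 < n%:R ^+ 2 :> R by rewrite exprn_gt0// ltr0n ltnW.
have Neps : N%:R * (eps * n%:R ^+ 2 / 2) <= 1536 * L%:R * n%:R ^+ 2.
  apply: le_trans (_ : N%:R * (\dim U - n)%:R <= _).
    by rewrite ler_wpM2l// ltW.
  by rewrite -natrX -!natrM ler_nat -mulnn.
(* Dividing by [n ^ 2 / 2] doubles 1536 to 3072, which is below the stated 3456. *)
have Neps' : N%:R * eps <= 3072 * L%:R by rewrite -(ler_pM2r nsq); lra.
rewrite mulrAC ler_pdivlMr//; apply: le_trans Neps' _.
by rewrite ler_wpM2r// ler_nat.
Qed.
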